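(* Let $K$ be a field, $a,b\in\mathbb{Z}_{\ge 0}$, $\ell=a+b$. Let $x_0,\dots,x_k\in K$ be distinct, let $a_0,\dots,a_k$ be positive integers with $a_0+\cdots+a_k=\ell+1$, and let $y_{i,j}\in K$ for $0\le i\le k$, $0\le j<a_i$. Put $\overline X=\big((x_0,a_0);\dots;(x_k,a_k)\big)$, $\boldsymbol{y}_i=(y_{i,0},\dots,y_{i,a_i-1})$ and $Y=(\boldsymbol{y}_0,\dots,\boldsymbol{y}_k)$, and let $V_{u+1}(\overline X)$ and $U_{u+1}(\overline X,Y)$ be the matrices defined in the context. Let $d$ be maximal such that $0\le d\le a$ and $$A_0:=-\det\begin{pmatrix}V_{d+1}(\overline X)&\mathbf{x}_d\\ U_{\ell-d+1}(\overline X,Y)&\mathbf 0\end{pmatrix}\in K[x]$$ is not identically zero (assuming that such a $d$ exists), where $\mathbf{x}_m$ denotes the column $(1,x,\dots,x^m)^{T}$ and $\mathbf 0$ a zero column. For this $d$ set $$B_0:=\det\begin{pmatrix}V_{d+1}(\overline X)&\mathbf 0\\ U_{\ell-d+1}(\overline X,Y)&\mathbf{x}_{\ell-d}\end{pmatrix}\in K[x].$$ (Both matrices are square of size $\ell+2$.) Then $\deg(B_0)\le b$, and a solution $\dfrac{A}{B}$ of the osculatory rational interpolation problem for these data exists if and only if $B_0(x_i)\ne0$ for all $0\le i\le k$. In that case the solution is given by $$\frac{A}{B}=\frac{A_0}{B_0}.$$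
   Context: **Osculatory rational interpolation problem.** Given the data, find polynomials $A,B\in K[x]$ with $\deg A\le a$, $\deg B\le b$, $B(x_i)\neq 0$ for all $i$ with $a_i\ge 1$, such that $(A/B)^{(j)}(x_i)=j!\,y_{i,j}$ for $0\le i\le k$, $0\le j<a_i$, understood as: the coefficient of $(x-x_i)^j$ in the Taylor expansion of $A/B$ at $x_i$ equals $y_{i,j}$. Such a pair (or the quotient $A/B$) is called a solution. The zero polynomial satisfies every degree bound. Equality of quotients is equality of rational functions. **Matrices.** Let $u\in\mathbb{Z}_{\ge0}$. Both matrices below have $u+1$ rows and $\ell+1$ columns, and $\binom{m}{j}x_i^{m-j}$ is understood to be $0$ when $m<j$. - The generalized Vandermonde (confluent) matrix is $V_{u+1}(\overline X)=\big(V_{u+1}(x_0,a_0)\,|\,\cdots\,|\,V_{u+1}(x_k,a_k)\big)$, where $V_{u+1}(x_i,a_i)\in K^{(u+1)\times a_i}$ has entry $\binom{m}{l}x_i^{m-l}$ in row $m+1$ and column $l+1$ ($0\le m\le u$, $0\le l<a_i$). - $U_{u+1}(\overline X,Y)=\big(U_{u+1}(x_0,\boldsymbol{y}_0)\,|\,\cdots\,|\,U_{u+1}(x_k,\boldsymbol{y}_k)\big)$, where $U_{u+1}(x_i,\boldsymbol{y}_i)\in K^{(u+1)\times a_i}$ has entry $\sum_{j=0}^{l}\binom{m}{j}\,y_{i,l-j}\,x_i^{m-j}$ in row $m+1$ and column $l+1$ ($0\le m\le u$, $0\le l<a_i$). *)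

(* Defs.v *)
From mathcomp Require Import all_boot all_order all_algebra.

Set Implicit Arguments.
Unset Strict Implicit.
Unset Printing Implicit Defensive.

Import GRing.Theory.
Local Open Scope ring_scope.

Section TaylorCoefficients.
Variable K : fieldType.
Implicit Types (p q A B : {poly K}) (x : K).

(* The first n coefficients of the quotient p / q in the ring of formal power
   series, by long division; meaningful when the constant term q`_0 is not 0. *)
Fixpoint series_div p q (n : nat) : seq K :=
  if n is n'.+1 then
    let c := series_div p q n' in
    rcons c ((p`_n' - \sum_(i < n') c`_i * q`_(n' - i)) / q`_0)
  else [::].

(* The coefficient of (X - x)^j in the Taylor expansion of A / B at x. *)
Definition taylor_coef A B x (j : nat) : K :=
  (series_div (A \Po ('X + x%:P)) (B \Po ('X + x%:P)) j.+1)`_j.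

Lemma size_series_div p q n : size (series_div p q n) = n.
Proof. by elim: n => //= n IHn; rewrite size_rcons IHn. Qed.

Lemma nth_series_div p q n j :
  (j < n)%N -> (series_div p q n)`_j = (series_div p q j.+1)`_j.
Proof.
elim: n => // n IHn; rewrite ltnS leq_eqVlt => /predU1P[-> // | ltjn].
by rewrite [LHS]/= nth_rcons size_series_div ltjn IHn.
Qed.

(* Sanity check: B(x + T) * (taylor expansion) = A(x + T) as power series,
   which determines the expansion. *)
Lemma taylor_coefP A B x (c : nat -> K) : B.[x] != 0 ->
  (forall n, \sum_(i < n.+1) c i * (B \Po ('X + x%:P))`_(n - i)
             = (A \Po ('X + x%:P))`_n)
  <-> c =1 taylor_coef A B x.
Proof.
set q := B \Po _; set p := A \Po _ => nzBx.
have nzq : q`_0 != 0.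
  by rewrite -horner_coef0 horner_comp hornerD hornerX hornerC add0r.
have tE n : taylor_coef A B x n
    = (p`_n - \sum_(i < n) taylor_coef A B x i * q`_(n - i)) / q`_0.
  rewrite {1}/taylor_coef -/p -/q /= nth_rcons size_series_div ltnn eqxx.
  congr ((_ - _) / _); apply: eq_bigr => i _.
  by rewrite nth_series_div.
split=> [cP n | cE n].
  elim/ltn_ind: n => n IHn; rewrite tE -cP big_ord_recr /= subnn.
  have -> : \sum_(i < n) taylor_coef A B x i * q`_(n - i)
            = \sum_(i < n) c i * q`_(n - i).
    by apply: eq_bigr => i _; rewrite IHn.
  by rewrite addrAC subrr add0r mulfK.
rewrite big_ord_recr /= subnn (cE n) tE mulfVK //.
rewrite (eq_bigr (fun i : 'I_n => taylor_coef A B x i * q`_(n - i))) => [|i _].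
  by rewrite addrC subrK.
by rewrite cE.
Qed.

End TaylorCoefficients.

Section OsculatoryInterpolation.
Variables (K : fieldType) (k : nat).
Variables (x : 'I_k.+1 -> K) (mult : 'I_k.+1 -> nat).
Variable y : forall i, (mult i).-tuple K.

Definition osculatory_solution (a b : nat) (A B : {poly K}) : Prop :=
  [/\ (size A <= a.+1)%N,
      (size B <= b.+1)%N,
      (forall i, (0 < mult i)%N -> B.[x i] != 0)
    & (forall i (j : 'I_(mult i)), taylor_coef A B (x i) j = (y i)`_j)].

Definition V_block (u : nat) (i : 'I_k.+1) : 'M[K]_(u.+1, mult i) :=
  \matrix_(m, l) (x i ^+ (m - l) *+ 'C(m, l)).

Definition V_mx (u : nat) : 'M[K]_(u.+1, \sum_i mult i) :=
  \mxrow_i V_block u i.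

Definition U_block (u : nat) (i : 'I_k.+1) : 'M[K]_(u.+1, mult i) :=
  \matrix_(m, l) \sum_(j < l.+1) ((y i)`_(l - j) * x i ^+ (m - j) *+ 'C(m, j)).

Definition U_mx (u : nat) : 'M[K]_(u.+1, \sum_i mult i) :=
  \mxrow_i U_block u i.

Definition X_col (m : nat) : 'cV[{poly K}]_m.+1 := \col_(i < m.+1) 'X^i.

Lemma rows_osc (l : nat) (d : 'I_l.+1) : (d.+1 + (l - d).+1 = l.+2)%N.
Proof. by rewrite addSn addnS subnKC // -ltnS. Qed.

Lemma cols_osc (n l : nat) : n = l.+1 -> (n + 1 = l.+2)%N.
Proof. by move=> ->; rewrite addn1. Qed.

Variables (l : nat) (sum_mult : (\sum_i mult i)%N = l.+1).

(* The casts only identify the block dimensions with l + 2. *)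
Definition A0_mx (d : 'I_l.+1) : 'M[{poly K}]_l.+2 :=
  castmx (rows_osc d, cols_osc sum_mult)
    (block_mx (map_mx polyC (V_mx d)) (X_col d)
              (map_mx polyC (U_mx (l - d))) 0).

Definition B0_mx (d : 'I_l.+1) : 'M[{poly K}]_l.+2 :=
  castmx (rows_osc d, cols_osc sum_mult)
    (block_mx (map_mx polyC (V_mx d)) 0
              (map_mx polyC (U_mx (l - d))) (X_col (l - d))).

Definition A0 (d : 'I_l.+1) : {poly K} := - \det (A0_mx d).

Definition B0 (d : 'I_l.+1) : {poly K} := \det (B0_mx d).

End OsculatoryInterpolation.

(* Main.v *)
(* Multiplying a row (-A | B) of coefficients by the stacked matrix (V ; U)
   gives the jets of -A + y B at the nodes, so its left kernel is the space of
   pairs (A, B), deg A <= d, deg B <= l - d, with A = y B modulo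
   M = prod_i (X - x_i)^(a_i). The cofactors along the last column form a kernel
   vector, whose two halves are -A0 and B0, and when A0 <> 0 they span the
   kernel. In particular a nonzero kernel pair has deg A = deg A0.
   - If deg B0 = l - e > b, then e < a and A0 vanishes for e + 1; its leading
     coefficient being a maximal minor, there is a nonzero pair with deg A <= e
     and deg B < l - e. Comparing degrees modulo M gives A B0 = A0 B, hence
     deg A < deg A0, a contradiction.
   - If A / B is a solution then A B0 = A0 B, again by degrees. If moreover
     B0(x_i) = 0 then A0(x_i) = 0 too, and dividing A0 and B0 by X - x_i leaves
     a pair in the kernel, because B is invertible modulo M; this again
     contradicts deg A = deg A0. *)
Require Import Defs.
From mathcomp Require Import all_boot all_order all_algebra.
From mathcomp Require Import ring zify.

Import GRing.Theory.
Local Open Scope ring_scope.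

(** * Cofactors along the last column of a bordered matrix *)

(** Cofactors along the last column do not involve that column, so one [c] serves every [u].
    Proportionality to [c] is Cramer's rule, in cross-product form since [c] may vanish. *)
Lemma bordered_det (K : fieldType) (m n n' : nat) (e1 : m = n')
    (e2 : (n + 1)%N = n') (N : 'M[K]_(m, n)) :
  exists c : 'rV[K]_m,
  [/\ c *m N = 0,
      forall u : 'cV[{poly K}]_m,
        \det (castmx (e1, e2) (row_mx (map_mx polyC N) u))
        = (map_mx polyC c *m u) 0 0,
      forall w : 'rV[K]_m, w *m N = 0 ->
        forall i j, c 0 i * w 0 j = w 0 i * c 0 j
    & forall i, c 0 i = 0 ->
        exists w : 'rV[K]_m, [/\ w != 0, w *m N = 0 & w 0 i = 0]].
Proof.
case: n' / e2 e1 => e1; subst m.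
(* The last row of the adjugate does not depend on the last column. *)
pose c (R : comNzRingType) (M : 'M[R]_(n + 1, n)) : 'rV[R]_(n + 1) :=
  dsubmx (\adj (row_mx M 0)).
have cE (R : comNzRingType) (M : 'M[R]_(n + 1, n)) u :
    c R M = dsubmx (\adj (row_mx M u)).
  apply/rowP => j; rewrite !mxE /cofactor; congr (_ * \det _).
  apply/matrixP => i' j'; rewrite !mxE.
  case: split_ordP => // t; rewrite (ord1 t) => tE.
  by have := neq_lift (rshift n 0 : 'I_(n + 1)) j'; rewrite tE eqxx.
have cu (R : comNzRingType) (M : 'M[R]_(n + 1, n)) u :
    c R M *m row_mx M u = row_mx 0 (\det (row_mx M u))%:M.
  rewrite (cE _ _ u) mul_dsub_mx mul_adj_mx scalar_mx_block.
  by rewrite block_mxEv col_mxKd.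
have cN (R : comNzRingType) (M : 'M[R]_(n + 1, n)) : c R M *m M = 0.
  by have := cu R M 0; rewrite mul_mx_row => /eq_row_mx[].
have cdet (R : comNzRingType) (M : 'M[R]_(n + 1, n)) u :
    \det (row_mx M u) = (c R M *m u) 0 0.
  by have := cu R M u; rewrite mul_mx_row => /eq_row_mx[_ ->]; rewrite !mxE.
have cdelta i : \det (row_mx N (delta_mx i 0)) = c K N 0 i.
  by rewrite cdet -colE mxE.
exists (c K N); split=> [|u|w wN i j|i ci0]; first exact: cN.
- rewrite castmx_id cdet; congr ((_ *m _) _ _).
  by rewrite /c map_dsubmx map_mx_adj map_row_mx map_mx0.
(* Multiplying by the adjugate turns this into [c 0 i *: w = w 0 i *: c]. *)
- have wD : w *m row_mx N (delta_mx i 0) = row_mx 0 (w 0 i)%:M.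
    rewrite mul_mx_row wN -colE; congr row_mx.
    by apply/rowP=> t; rewrite (ord1 t) !mxE.
  have := congr1 (mulmx^~ (\adj (row_mx N (delta_mx i 0)))) wD.
  rewrite -mulmxA mul_mx_adj mul_mx_scalar cdelta.
  rewrite -[\adj _ as X in _ = _ *m X]vsubmxK mul_row_col mul0mx add0r.
  by rewrite -cE mul_scalar_mx => /rowP/(_ j); rewrite !mxE.
(* A left null vector of [N] bordered by the unit column [i] kills [N] and has entry [i] zero. *)
- have /det0P[w w0] : \det (row_mx N (delta_mx i 0)) == 0 by rewrite cdelta ci0.
  rewrite mul_mx_row -[RHS]row_mx0 => /eq_row_mx[wN wi]; exists w; split=> //.
  by have := congr1 (fun M : 'M_1 => M 0 0) wi; rewrite -colE !mxE.
Qed.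

(** * Taylor coefficients after moving the node to the origin *)

Lemma dvdXnP (K : fieldType) (n : nat) (p : {poly K}) :
  reflect (forall i, (i < n)%N -> p`_i = 0) ('X^n %| p).
Proof.
apply: (iffP idP) => [/dvdpP[q ->] i ltin | p0].
  by rewrite coefMXn ltin.
rewrite -(poly_take_drop n p) [take_poly n p](_ : _ = 0) ?add0r ?dvdp_mull //.
by apply/polyP=> i; rewrite coef_take_poly coef0; case: ifP => // /p0.
Qed.

Lemma dvd_XsubC_exp_shift (K : fieldType) (n : nat) (z : K) (p : {poly K}) :
  (('X - z%:P) ^+ n %| p) = ('X^n %| p \Po ('X + z%:P)).
Proof.
apply/idP/idP => /dvdp_comp_poly.
  by move/(_ ('X + z%:P)); rewrite rmorphXn /= comp_polyB comp_polyX comp_polyC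
    addrK.
by move/(_ ('X - z%:P)); rewrite comp_polyXaddC_K rmorphXn /= comp_polyX.
Qed.

(** The sum is a row vector times a confluent Vandermonde column; it runs to [n], not to the size of
    [p], to fit vectors of fixed length. *)
Lemma coef_shift (K : fieldType) (n : nat) (z : K) (p : {poly K}) (l : nat) :
  (size p <= n)%N ->
  (p \Po ('X + z%:P))`_l = \sum_(m < n) p`_m * (z ^+ (m - l) *+ 'C(m, l)).
Proof.
move=> le_pn; rewrite (_ : p \Po _ = \sum_(m < n) p`_m *: ('X + z%:P) ^+ m).
  rewrite coef_sum; apply: eq_bigr => m _; rewrite coefZ addrC exprDn coef_sum.
  congr (_ * _); rewrite (eq_bigr (fun i : 'I_m.+1 =>
    if i == l :> nat then z ^+ (m - l) *+ 'C(m, l) else 0)) => [|i _].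
    rewrite -big_mkcond /=; case: (ltnP m l) => [ltml | leml].
      by rewrite bin_small // mulr0n big1.
    by rewrite (big_pred1 (Ordinal (leml : l < m.+1)%N)).
  rewrite coefMn -rmorphXn /= coefCM coefXn eq_sym.
  by case: eqP => [->|_]; rewrite ?mulr1 // mulr0 mul0rn.
rewrite comp_polyE (big_ord_widen n (fun m => p`_m *: ('X + z%:P) ^+ m)) //.
rewrite big_mkcond; apply: eq_bigr => m _.
by case: ltnP => // /(nth_default 0) ->; rewrite scale0r.
Qed.

(** * Interpolation conditions as congruences at the nodes *)

Section NodeCongruences.
Variables (K : fieldType) (k : nat) (x : 'I_k.+1 -> K) (mult : 'I_k.+1 -> nat).
Variable y : forall i : 'I_k.+1, (mult i).-tuple K.
Hypothesis x_inj : injective x.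
Implicit Types A B : {poly K}.

(* [A / B] matches the data in the linearised sense: [A = y B] to order
   [mult i] at [x i], where [B] is allowed to vanish. *)
Definition linearized A B : Prop :=
  forall i, ('X - (x i)%:P) ^+ mult i
            %| A - (Poly (y i) \Po ('X - (x i)%:P)) * B.

Lemma linearizedP A B :
  linearized A B <->
  forall i l, (l < mult i)%N ->
    (A \Po ('X + (x i)%:P))`_l
    = \sum_(j < l.+1) (y i)`_(l - j) * (B \Po ('X + (x i)%:P))`_j.
Proof.
have compXX i : ('X - (x i)%:P) \Po ('X + (x i)%:P) = 'X.
  by rewrite comp_polyB comp_polyX comp_polyC addrK.
have shiftE i l : ((A - (Poly (y i) \Po ('X - (x i)%:P)) * B)
      \Po ('X + (x i)%:P))`_l
    = (A \Po ('X + (x i)%:P))`_l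
      - \sum_(j < l.+1) (y i)`_(l - j) * (B \Po ('X + (x i)%:P))`_j.
  rewrite comp_polyB comp_polyM -comp_polyA compXX comp_polyXr coefB coefMr.
  by congr (_ - _); apply: eq_bigr => j _; rewrite coef_Poly.
split=> linAB i.
  move=> l ltl; have := linAB i.
  rewrite dvd_XsubC_exp_shift => /dvdXnP/(_ l ltl).
  by rewrite shiftE => /eqP; rewrite subr_eq0 => /eqP.
rewrite dvd_XsubC_exp_shift; apply/dvdXnP => l ltl.
by rewrite shiftE (linAB i l ltl) subrr.
Qed.

(** At each node [B] is invertible as a power series, so the congruence determines the first
    [mult i] coefficients of the quotient. *)
Lemma linearized_taylor A B : (forall i, B.[x i] != 0) ->
  linearized A B <->
  forall i (j : 'I_(mult i)), taylor_coef A B (x i) j = (y i)`_j.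
Proof.
move=> nzB.
have tP i := (taylor_coefP A (taylor_coef A B (x i)) (nzB i)).2 (frefl _).
have nzB0 i : (B \Po ('X + (x i)%:P))`_0 != 0.
  by rewrite -horner_coef0 horner_comp hornerD hornerX hornerC add0r.
have revE (s : nat -> K) (q : {poly K}) l :
    \sum_(j < l.+1) s (l - j)%N * q`_j = \sum_(j < l.+1) s j * q`_(l - j).
  rewrite (reindex_inj rev_ord_inj); apply: eq_bigr => j _.
  by rewrite /= subSS subKn // -ltnS.
split=> [/linearizedP linAB i [j /= ltj] | tAB].
  elim/ltn_ind: j ltj => j IHj ltj.
  have := linAB i j ltj; rewrite -tP (revE (fun j => (y i)`_j)).
  rewrite !big_ord_recr /= subnn.
  (* By induction the two convolutions agree before their last terms; there the nonzero constant
     term of the shifted [B] cancels. *)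
  rewrite (eq_bigr (fun n : 'I_j => (y i)`_n * (B \Po ('X + (x i)%:P))`_(j - n))).
    by move=> /addrI /(mulIf (nzB0 i)).
  by move=> n _; rewrite IHj // (ltn_trans _ ltj).
apply/linearizedP => i l ltl.
rewrite -tP (revE (fun j => (y i)`_j)); apply: eq_bigr => j _.
by rewrite (tAB i (Ordinal (leq_trans (ltn_ord j) ltl))).
Qed.

Lemma ker_linearized (d e : nat) (u : 'rV[K]_d.+1) (v : 'rV[K]_e.+1) :
  row_mx u v *m col_mx (V_mx x mult d) (U_mx x y e) = 0
  <-> linearized (- rVpoly u) (rVpoly v).
Proof.
rewrite mul_row_col /V_mx /U_mx !mul_mxrow linearizedP.
have entry i (l : 'I_(mult i)) :
    (u *m V_block x mult d i + v *m U_block x y e i) 0 l =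
    (rVpoly u \Po ('X + (x i)%:P))`_l
    + \sum_(j < l.+1) (y i)`_(l - j) * (rVpoly v \Po ('X + (x i)%:P))`_j.
  rewrite !mxE (@coef_shift _ d.+1) ?size_poly //; congr (_ + _).
    by apply: eq_bigr => m _; rewrite !mxE coef_rVpoly_ord.
  rewrite (eq_bigr (fun m : 'I_e.+1 => \sum_(j < l.+1)
      (y i)`_(l - j) * (v 0 m * (x i ^+ (m - j) *+ 'C(m, j))))) => [|m _].
    rewrite exchange_big; apply: eq_bigr => j _.
    rewrite (@coef_shift _ e.+1) ?size_poly // mulr_sumr.
    by apply: eq_bigr => m _; rewrite coef_rVpoly_ord.
  by rewrite !mxE mulr_sumr; apply: eq_bigr => j _; rewrite -mulrnAr mulrCA.
split=> [uv0 i l ltl | linuv].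
  have /rowP/(_ (Ordinal ltl)) : u *m V_block x mult d i + v *m U_block x y e i = 0.
    by have /mxrowP/(_ i) := uv0; rewrite submxrowD !mxrowK submxrow0.
  rewrite entry mxE /= raddfN coefN => /eqP.
  by rewrite addrC addr_eq0 => /eqP ->.
apply/mxrowP => i; rewrite submxrowD !mxrowK submxrow0; apply/rowP => l.
by rewrite entry mxE -linuv // raddfN coefN addrN.
Qed.

(** Powers of linear factors at distinct nodes are pairwise coprime. *)
Lemma node_prod_dvd (p : {poly K}) :
  (forall i, ('X - (x i)%:P) ^+ mult i %| p) ->
  \prod_i ('X - (x i)%:P) ^+ mult i %| p.
Proof.
move=> dvdp; elim: (index_enum _) (index_enum_uniq 'I_k.+1) => [|i s IHs] /=.
  by rewrite big_nil dvd1p.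
case/andP=> i_s /IHs dvds; rewrite big_cons Gauss_dvdp ?dvdp //.
apply: coprimep_expl; rewrite coprimep_sym coprimep_XsubC.
rewrite /root horner_prod prodf_seq_neq0; apply/allP => j js /=.
rewrite horner_exp !hornerE expf_neq0 // subr_eq0 (inj_eq x_inj).
by apply: contraNneq i_s => ->.
Qed.

Lemma eq0_of_node_dvd (p : {poly K}) : (size p <= \sum_i mult i)%N ->
  (forall i, ('X - (x i)%:P) ^+ mult i %| p) -> p = 0.
Proof.
move=> le_p /node_prod_dvd dvdp; apply: contraTeq le_p => p0.
rewrite -ltnNge; apply: leq_trans (dvdp_leq p0 dvdp).
rewrite size_prod => [|i _]; last by rewrite expf_neq0 // polyXsubC_eq0.
(* Each factor has size [mult i + 1]; the extra ones cancel the number of nodes subtracted by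
   [size_prod]. *)
under [X in (_ < X.+1 - _)%N]eq_bigr => i _ do rewrite size_exp_XsubC -addn1.
by rewrite big_split /= sum1_card -addSn addnK.
Qed.

Lemma linearized_cross A1 B1 A2 B2 : linearized A1 B1 -> linearized A2 B2 ->
  (size (A1 * B2)%R <= \sum_i mult i)%N -> (size (A2 * B1)%R <= \sum_i mult i)%N ->
  A1 * B2 = A2 * B1.
Proof.
move=> lin1 lin2 le1 le2; apply/eqP; rewrite -subr_eq0; apply/eqP.
apply: eq0_of_node_dvd => [|i].
  by rewrite (leq_trans (size_polyD _ _)) // geq_max le1 size_polyN.
set H := Poly (y i) \Po ('X - (x i)%:P).
(* The terms in [H] cancel, leaving a combination of the two congruences. *)
rewrite (_ : A1 * B2 - A2 * B1 = (A1 - H * B1) * B2 - (A2 - H * B2) * B1).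
  by apply: dvdp_sub; apply: dvdp_mulr; [apply: lin1 | apply: lin2].
ring.
Qed.

(** The third clause holds because the coefficient of degree [d] in [A0d] is, up to sign, the
    cofactor at the last row of the [V] block; if it vanishes, some nonzero kernel vector has no
    entry there. *)
Lemma cofactor_solution (l : nat) (sum_mult : (\sum_i mult i)%N = l.+1)
    (d : 'I_l.+1) :
  let A0d := A0 x y sum_mult d in
  let B0d := B0 x y sum_mult d in
  [/\ [/\ (size A0d <= d.+1)%N, (size B0d <= (l - d).+1)%N
        & linearized A0d B0d],
      A0d != 0 -> forall A B, (size A <= d.+1)%N -> (size B <= (l - d).+1)%N ->
        linearized A B -> exists r, A = r *: A0d /\ B = r *: B0d
    & A0d`_d = 0 -> exists A B, [/\ (size A <= d)%N, (size B <= (l - d).+1)%N,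
        linearized A B & (A, B) != (0, 0)]].
Proof.
move=> A0d B0d.
have [c [cN cdet cprop cker]] := bordered_det _ _ _ _ (rows_osc d)
  (cols_osc sum_mult) (col_mx (V_mx x mult d) (U_mx x y (l - d))).
have polyE n (w : 'rV[K]_n.+1) : (map_mx polyC w *m X_col K n) 0 0 = rVpoly w.
  rewrite mxE /rVpoly poly_def; apply: eq_bigr => i _.
  rewrite !mxE insubT // => lti; rewrite mul_polyC.
  by congr (w _ _ *: _); apply: val_inj.
have A0E : A0d = - rVpoly (lsubmx c).
  rewrite /A0d /A0 /A0_mx block_mxEh -map_col_mx cdet -{1}(hsubmxK c) map_row_mx.
  by rewrite mul_row_col mulmx0 addr0 polyE.
have B0E : B0d = rVpoly (rsubmx c).
  rewrite /B0d /B0 /B0_mx block_mxEh -map_col_mx cdet -{1}(hsubmxK c) map_row_mx.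
  by rewrite mul_row_col mulmx0 add0r polyE.
split.
- split; rewrite ?A0E ?B0E ?size_polyN ?size_poly //.
  by apply/ker_linearized; rewrite hsubmxK.
- move=> nzA A B leA leB linAB.
  have [i nzc] : exists i, c 0 i != 0.
    apply/existsP; apply: contraNT nzA => /existsPn c0.
    rewrite A0E (_ : c = 0) ?linear0 ?oppr0 //.
    by apply/rowP => i; rewrite mxE; apply/eqP; have := c0 i; rewrite negbK.
  pose w : 'rV_(d.+1 + (l - d).+1) := row_mx (- poly_rV A) (poly_rV B).
  have wN : w *m col_mx (V_mx x mult d) (U_mx x y (l - d)) = 0.
    by apply/ker_linearized; rewrite raddfN /= opprK !poly_rV_K.
  have wE : w = (w 0 i / c 0 i) *: c.
    by apply/rowP => j; rewrite [RHS]mxE mulrAC -cprop // mulrAC mulfV ?mul1r.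
  exists (w 0 i / c 0 i); rewrite A0E B0E scalerN -!linearZ /= -wE.
  by rewrite row_mxKl row_mxKr raddfN /= opprK !poly_rV_K.
- move=> A0d0; have [|w [w0 wN wd]] := cker (lshift _ ord_max).
    apply/eqP; rewrite -oppr_eq0 -A0d0 A0E coefN (coef_rVpoly_ord _ ord_max).
    by rewrite mxE.
  exists (- rVpoly (lsubmx w)), (rVpoly (rsubmx w)); split.
  + rewrite size_polyN; apply/leq_sizeP => j; rewrite leq_eqVlt.
    case/predU1P => [<-|ltj]; first by rewrite (coef_rVpoly_ord _ ord_max) mxE.
    by rewrite nth_default // (leq_trans (size_poly _ _)).
  + exact: size_poly.
  + by apply/ker_linearized; rewrite hsubmxK.
  + apply: contraNneq w0 => -[/eqP]; rewrite oppr_eq0 => /eqP wl0 wr0.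
    rewrite -(hsubmxK w) -(rVpolyK (lsubmx w)) -(rVpolyK (rsubmx w)) wl0 wr0.
    by rewrite !linear0 row_mx0.
Qed.
End NodeCongruences.

(** * Degree comparison and the solvability criterion *)

Arguments linearized {K k} x {mult} y A B.
Arguments cofactor_solution {K k} x {mult} y {l} sum_mult d.
Arguments linearized_cross {K k x mult y} x_inj {A1 B1 A2 B2}.
Arguments linearized_taylor {K k x mult y A B}.

Theorem theorem4p2 (K : fieldType) (a b k : nat)
    (x : 'I_k.+1 -> K) (mult : 'I_k.+1 -> nat)
    (y : forall i : 'I_k.+1, (mult i).-tuple K)
    (x_inj : injective x)
    (mult_gt0 : forall i : 'I_k.+1, (0 < mult i)%N)
    (sum_mult : (\sum_i mult i)%N = (a + b).+1)
    (d : 'I_(a + b).+1)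
    (d_le_a : (d <= a)%N)
    (A0_neq0 : A0 x y sum_mult d != 0)
    (d_max : forall d' : 'I_(a + b).+1,
       (d' <= a)%N -> A0 x y sum_mult d' != 0 -> (d' <= d)%N) :
  let Ad := A0 x y sum_mult d in
  let Bd := B0 x y sum_mult d in
  [/\ (size Bd <= b.+1)%N,
      (exists A B : {poly K}, osculatory_solution x y a b A B)
        <-> (forall i : 'I_k.+1, Bd.[x i] != 0)
    & (forall i : 'I_k.+1, Bd.[x i] != 0) ->
        osculatory_solution x y a b Ad Bd
        /\ (forall A B : {poly K}, osculatory_solution x y a b A B ->
              FracField.tofrac A / FracField.tofrac B
              = FracField.tofrac Ad / FracField.tofrac Bd)].

Proof.
move=> Ad Bd.
have [[sAd sBd linAB] uniq _] := cofactor_solution x y sum_mult d.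
rewrite -/Ad -/Bd in sAd sBd linAB uniq.
(* The pair is [r] times [(Ad, Bd)], and a nonzero [r] would preserve the size of [Ad]. *)
have minAB (A B : {poly K}) : (size A < size Ad)%N -> (size B <= (a + b - d).+1)%N ->
    linearized x y A B -> (A, B) = (0, 0).
  move=> ltA leB lin.
  have [|r [AE BE]] := uniq A0_neq0 A B _ leB lin.
    exact: leq_trans (ltnW ltA) sAd.
  have [r0|r0] := eqVneq r 0; first by rewrite AE BE r0 !scale0r.
  by move: ltA; rewrite AE size_scale // ltnn.
have cross (A B : {poly K}) : (size A + size Bd <= (a + b).+2)%N ->
    (d + size B <= (a + b).+1)%N -> linearized x y A B -> A * Bd = Ad * B.
  move=> le1 le2 lin; apply: (linearized_cross x_inj) lin linAB _ _;
    rewrite sum_mult (leq_trans (size_polyMleq _ _)) //; lia.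
have sBd_b : (size Bd <= b.+1)%N.
  rewrite leqNgt; apply/negP => ltb.
  (* This index is [a + b - deg Bd + 1]: at most [a] since [deg Bd > b], and above [d] since
     [deg Bd <= a + b - d]. *)
  have lte : (((a + b).+1 - size Bd).+1 < (a + b).+1)%N by lia.
  have [d' d'E] : exists d' : 'I_(a + b).+1,
      d' = ((a + b).+1 - size Bd).+1 :> nat.
    by exists (Ordinal lte).
  have A00 : A0 x y sum_mult d' = 0.
    apply/eqP; apply: contraT => nz.
    have led' : (d' <= d)%N by apply: d_max => //; lia.
    lia.
  have [_ _] := cofactor_solution x y sum_mult d'.
  rewrite A00 coef0 => /(_ erefl)[A [B [leA leB lin]]].
  (* By the choice of [d'], [leB] says [size B < size Bd], so this identity forces
     [size A < size Ad]. *)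
  have AB : A * Bd = Ad * B by apply: cross lin; lia.
  rewrite minAB ?eqxx //; last by lia.
  have [->|A_neq0] := eqVneq A 0; first by rewrite size_poly0 size_poly_gt0.
  have Bd_neq0 : Bd != 0 by rewrite -size_poly_gt0; lia.
  have B_neq0 : B != 0.
    by apply: contra_neq (mulf_neq0 A_neq0 Bd_neq0) => B0'; rewrite AB B0' mulr0.
  have sAB : (size A + size Bd).-1 = (size Ad + size B).-1.
    by rewrite -!size_mul // AB.
  by move: A_neq0 Bd_neq0 B_neq0; rewrite -!size_poly_gt0; lia.
have sol_lin A B : osculatory_solution x y a b A B ->
    linearized x y A B /\ A * Bd = Ad * B.
  move=> [sA sB nzB tAB]; have lin : linearized x y A B.
    by apply/linearized_taylor => // i; apply: nzB.
  by split=> //; apply: cross lin; lia.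
have nz_sol : (forall i, Bd.[x i] != 0) -> osculatory_solution x y a b Ad Bd.
  move=> nzBd; split=> //; first exact: leq_trans sAd _.
  by apply/linearized_taylor.
split=> //.
- split=> [[A [B solAB]] i|/nz_sol]; last by exists Ad, Bd.
  have [linAB' ABd] := sol_lin _ _ solAB; case: solAB => _ _ nzB _.
  apply/negP => Bdi.
  have /factor_theorem[B1 B1E] : root Bd (x i) by [].
  (* Since [B] is nonzero at [x i], the root passes from [Bd] to [Ad] through [ABd]. *)
  have /factor_theorem[A1 A1E] : root Ad (x i).
    have := congr1 (horner^~ (x i)) ABd; rewrite /= !hornerM (eqP Bdi) mulr0.
    by move/esym/eqP; rewrite mulf_eq0 (negPf (nzB i _)) // orbF.
  have nzX : 'X - (x i)%:P != 0 by rewrite polyXsubC_eq0.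
  have AB1 : A * B1 = A1 * B.
    by apply: (mulIf nzX); rewrite -mulrA -B1E ABd A1E mulrAC.
  have A1_neq0 : A1 != 0.
    by apply: contraNneq A0_neq0 => A10; rewrite -/Ad A1E A10 mul0r.
  have [A10 _] : (A1, B1) = (0, 0); last by rewrite A10 eqxx in A1_neq0.
  apply: minAB => [||j].
  + by rewrite A1E size_Mmonic ?monicXsubC // size_XsubC addn2.
  + apply: leq_trans sBd; have [->|B1_neq0] := eqVneq B1 0.
      by rewrite size_poly0.
    by rewrite B1E size_Mmonic ?monicXsubC // size_XsubC addn2 /= leqnSn.
  + have cop : coprimep (('X - (x j)%:P) ^+ mult j) B.
      by apply: coprimep_expl; rewrite coprimep_sym coprimep_XsubC; apply: nzB.
    (* By [AB1], [B] times the residue of [(A1, B1)] is [B1] times that of [(A, B)]; [B] cancels,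
       being coprime to the modulus. *)
    rewrite -(Gauss_dvdpr _ cop) mulrBr (mulrC B A1) -AB1.
    rewrite mulrCA mulrA -mulrBl; apply: dvdp_mulr; exact: linAB'.
- move=> nzBd; split=> [|A B solAB]; first exact: nz_sol.
  have [_ ABd] := sol_lin _ _ solAB; case: solAB => _ _ nzB _.
  have neq0 (p : {poly K}) : p.[x ord0] != 0 -> FracField.tofrac p != 0.
    by rewrite tofrac_eq0; apply: contraNneq => ->; rewrite horner0.
  apply/eqP; rewrite eqr_div ?neq0 ?nzB //.
  by rewrite -!tofracM ABd.
Qed.
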